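(* Let $p\in[0,1]$ satisfy $p\ge_T\emptyset'$. Then there is $y\notin\mathsf{MLR}_{\mu_p}$ such that no blind $p$-supermartingale succeeds on $y$.
   Context: For $p\in[0,1]$ the Bernoulli measure $\mu_p$ on $2^\omega$ is determined by $\mu_p(\sigma)=p^{\#_0(\sigma)}(1-p)^{\#_1(\sigma)}$, where $\#_i(\sigma)$ is the number of occurrences of $i$ in $\sigma$; $p$ is identified with its binary expansion. $\mathsf{MLR}_{\mu_p}$ is the set of sequences Martin-Löf random for $\mu_p$ relative to oracle $p$. A semimeasure is $\delta:2^{<\omega}\to[0,1]$ with $\delta(\emptyset)\le1$ and $\delta(\sigma)\ge\delta(\sigma0)+\delta(\sigma1)$; it is left-c.e. (unrelativized) if its values are uniformly limits of computable nondecreasing sequences of rationals. A blind $p$-supermartingale is a function of the form $M=\delta/\mu_p$ (i.e. $M(\sigma)=\delta(\sigma)/\mu_p(\sigma)$) where $\delta$ is a left-c.e. semimeasure. $M$ succeeds on $y$ if $\limsup_n M(y\upharpoonright n)=\infty$. *)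

(* Defs.v *)
From Stdlib Require Import Reals List Arith.
Import ListNotations.
Open Scope R_scope.

Inductive code : Type :=
| CZero : code
| CSucc : code
| CProj : nat -> code
| COrc  : code
| CComp : code -> list code -> code
| CPrimRec : code -> code -> code
| CMu : code -> code.

Fixpoint seq_opt (l : list (option nat)) : option (list nat) :=
  match l with
  | [] => Some []
  | None :: _ => None
  | Some v :: l' => match seq_opt l' with Some vs => Some (v :: vs) | None => None end
  end.

(* fuel-bounded evaluation with oracle O (arity mismatches use defaults) *)
Fixpoint eval (fuel : nat) (orc : nat -> bool) (c : code) (xs : list nat)
  {struct fuel} : option nat :=
  match fuel with
  | 0%nat => None
  | S k =>
    match c with
    | CZero => Some 0%nat
    | CSucc => Some (S (hd 0%nat xs))
    | CProj i => Some (nth i xs 0%nat)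
    | COrc => Some (if orc (hd 0%nat xs) then 1%nat else 0%nat)
    | CComp f gs =>
        match seq_opt (map (fun g => eval k orc g xs) gs) with
        | Some ys => eval k orc f ys
        | None => None
        end
    | CPrimRec b s =>
        match xs with
        | [] => None
        | n :: rest =>
          (fix rec (m : nat) : option nat :=
             match m with
             | 0%nat => eval k orc b rest
             | S m' => match rec m' with
                       | Some r => eval k orc s (m' :: r :: rest)
                       | None => None
                       end
             end) n
        end
    | CMu f =>
        (fix go (j bound : nat) : option nat :=
           match bound with
           | 0%nat => None
           | S bound' => match eval k orc f (j :: xs) with
                         | Some 0%nat => Some j
                         | Some _ => go (S j) bound'
                         | None => None
                         end
           end) 0%nat k
    end
  end.

Definition converges (O : nat -> bool) (c : code) (xs : list nat) (v : nat) : Prop :=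
  exists fuel, eval fuel O c xs = Some v.

Definition halts (O : nat -> bool) (c : code) (xs : list nat) : Prop :=
  exists v, converges O c xs v.

Definition no_oracle : nat -> bool := fun _ => false.

Definition npair (a b : nat) : nat := ((a + b) * (a + b + 1) / 2 + b)%nat.

Fixpoint encode (c : code) : nat :=
  match c with
  | CZero => npair 0 0
  | CSucc => npair 1 0
  | CProj i => npair 2 i
  | COrc => npair 3 0
  | CComp f gs =>
      npair 4 (npair (encode f)
        ((fix encl (l : list code) : nat :=
            match l with [] => 0%nat | g :: l' => S (npair (encode g) (encl l')) end) gs))
  | CPrimRec b s => npair 5 (npair (encode b) (encode s))
  | CMu f => npair 6 (encode f)
  end.

Definition halting_set (n : nat) : Prop :=
  exists c, encode c = n /\ halts no_oracle c [n].

Definition turing_reducible (A : nat -> Prop) (O : nat -> bool) : Prop :=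
  exists c, forall n, (A n -> converges O c [n] 1%nat) /\ (~ A n -> converges O c [n] 0%nat).

(* bit 0 = false, bit 1 = true *)
Definition str := list bool.

Fixpoint enc_str (s : str) : nat :=
  match s with
  | [] => 0%nat
  | b :: s' => (2 * enc_str s' + 1 + (if b then 1 else 0))%nat
  end.

Fixpoint prefix (y : nat -> bool) (n : nat) : str :=
  match n with
  | 0%nat => []
  | S m => prefix y m ++ [y m]
  end.

Definition is_prefix (s t : str) : Prop := exists u, t = s ++ u.

Definition count0 (s : str) : nat := count_occ Bool.bool_dec s false.
Definition count1 (s : str) : nat := count_occ Bool.bool_dec s true.

(* p identified with its binary expansion pb : pr = sum_i pb(i) 2^{-(i+1)} *)
Definition bin_partial (pb : nat -> bool) (n : nat) : R :=
  fold_right Rplus 0 (map (fun i => if pb i then (/2) ^ (S i) else 0) (seq 0 n)).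

Definition is_binary_expansion (pb : nat -> bool) (pr : R) : Prop :=
  Un_cv (bin_partial pb) pr.

Definition mu (pr : R) (s : str) : R := pr ^ count0 s * (1 - pr) ^ count1 s.

Definition test_set (O : nat -> bool) (c : code) (n : nat) (s : str) : Prop :=
  halts O c [n; enc_str s].

Definition prefix_free (L : list str) : Prop :=
  ForallOrdPairs (fun a b => ~ is_prefix a b /\ ~ is_prefix b a) L.

(* mu([U_n]) <= 2^{-n}, written out: every finite prefix-free subset of U_n
   has total measure <= 2^{-n} *)
Definition ML_test (pb : nat -> bool) (pr : R) (c : code) : Prop :=
  forall n (L : list str), prefix_free L -> Forall (test_set pb c n) L ->
    fold_right Rplus 0 (map (mu pr) L) <= (/2) ^ n.

Definition in_open (U : str -> Prop) (y : nat -> bool) : Prop :=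
  exists k, U (prefix y k).

Definition MLR_bern (pb : nat -> bool) (pr : R) (y : nat -> bool) : Prop :=
  forall c, ML_test pb pr c -> ~ (forall n, in_open (test_set pb c n) y).

Definition semimeasure (d : str -> R) : Prop :=
  (forall s, 0 <= d s <= 1) /\ d [] <= 1 /\
  (forall s, d (s ++ [false]) + d (s ++ [true]) <= d s).

Definition left_ce (d : str -> R) : Prop :=
  exists ca cb ce : code, exists a b e : nat -> nat -> nat,
    (forall s t, converges no_oracle ca [enc_str s; t] (a (enc_str s) t)
               /\ converges no_oracle cb [enc_str s; t] (b (enc_str s) t)
               /\ converges no_oracle ce [enc_str s; t] (e (enc_str s) t)) /\
    let q s t := (INR (a (enc_str s) t) - INR (b (enc_str s) t)) / INR (S (e (enc_str s) t)) in
    (forall s t, q s t <= q s (S t)) /\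
    (forall s, Un_cv (q s) (d s)).

Definition left_ce_semimeasure (d : str -> R) : Prop := semimeasure d /\ left_ce d.

Definition blind_supermartingale (pr : R) (d : str -> R) : str -> R :=
  fun s => d s / mu pr s.

Definition succeeds (M : str -> R) (y : nat -> bool) : Prop :=
  forall B : R, forall N : nat, exists n, (N <= n)%nat /\ B < M (prefix y n).

(* Main.v *)
Require Import Defs.
From Stdlib Require Import Reals List Arith Lra Lia ClassicalEpsilon.
Import ListNotations.
Open Scope nat_scope.

(** Since [p] computes the halting problem, it can decide whether [F (s0)]
    exceeds a given rational, uniformly in the code of a left-c.e. function [F].
    Let [P] be the product measure whose [i]-th parameter is the truncation of
    [p] to [J + i] bits; [P] is rational-valued and at most a constant times
    [mu_p].  If [F] is a semimeasure bounded by [P] at [s], the greedy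
    choice (next bit 1 iff [F (s0) > P (s0)]) keeps it bounded by [P], so the
    greedy sequence of [F] is computable from [p] and the code of [F].

    To defeat all semimeasures [d_0, d_1, ...] one switches from [F_i] to a
    mixture [F_(i+1)] of [F_i] and a tiny multiple of [d_i] on long strings only.
    The resulting [y] need not be computable from [p], but it has an initial
    segment of length [L * (g + i + 1)] equal to a greedy string of [F_i], where
    [g] is the code of [F_i].  For fixed [i] there is only one such string for
    each [g], of measure at most [3^-(g + i + 1)]; these strings make up the
    [i]-th level of a Martin-Loef test. *)

(** * Fuel-bounded evaluation: monotonicity and convergence *)

Definition prec_eval (b : option nat) (s : nat -> nat -> option nat) :=
  fix rec (m : nat) : option nat :=
    match m with
    | 0 => b
    | S m' => match rec m' with Some r => s m' r | None => None end
    end.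

Definition mu_eval (f : nat -> option nat) :=
  fix go (j bound : nat) : option nat :=
    match bound with
    | 0 => None
    | S bound' => match f j with
                  | Some 0 => Some j
                  | Some _ => go (S j) bound'
                  | None => None
                  end
    end.

(** Holds by conversion: [prec_eval] and [mu_eval] are the anonymous inner fixpoints of [eval],
    named so that inductions can speak of them. *)
Lemma eval_CPrimRec k O b s n rest :
  eval (S k) O (CPrimRec b s) (n :: rest) =
  prec_eval (eval k O b rest) (fun m r => eval k O s (m :: r :: rest)) n.
Proof. reflexivity. Qed.

Lemma eval_CMu k O f xs :
  eval (S k) O (CMu f) xs = mu_eval (fun j => eval k O f (j :: xs)) 0 k.
Proof. reflexivity. Qed.

Lemma seq_opt_map_mono (A : Type) (f f' : A -> option nat) l ys :
  (forall g v, f g = Some v -> f' g = Some v) ->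
  seq_opt (map f l) = Some ys -> seq_opt (map f' l) = Some ys.
Proof.
  intros H; revert ys; induction l as [|a l IH]; simpl; intros ys; auto.
  destruct (f a) eqn:E; [|discriminate].
  rewrite (H _ _ E).
  destruct (seq_opt (map f l)); [|discriminate].
  intros [= <-]. now rewrite (IH _ eq_refl).
Qed.

Lemma prec_eval_mono b b' s s' n v :
  (forall v, b = Some v -> b' = Some v) ->
  (forall m r v, s m r = Some v -> s' m r = Some v) ->
  prec_eval b s n = Some v -> prec_eval b' s' n = Some v.
Proof.
  intros Hb Hs; revert v; induction n as [|n IH]; simpl; intros v; auto.
  destruct (prec_eval b s n); [|discriminate].
  rewrite (IH _ eq_refl); auto.
Qed.

(** The bound may grow together with the function because [eval] uses its fuel both to evaluate the
    body and to bound the search. *)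
Lemma mu_eval_mono f f' j k k' v :
  (forall j v, f j = Some v -> f' j = Some v) -> k <= k' ->
  mu_eval f j k = Some v -> mu_eval f' j k' = Some v.
Proof.
  intros Hf; revert j k'; induction k as [|k IH]; simpl; intros j k' Hk; [discriminate|].
  destruct k' as [|k']; [lia|]; simpl.
  destruct (f j) as [w|] eqn:E; [|discriminate].
  rewrite (Hf _ _ E). destruct w; auto. apply IH; lia.
Qed.

Lemma eval_mono O k k' c xs v :
  eval k O c xs = Some v -> k <= k' -> eval k' O c xs = Some v.
Proof.
  revert k' c xs v; induction k as [|k IH]; intros k' c xs v H Hk; [discriminate|].
  destruct k' as [|k']; [lia|].
  assert (M : forall c xs v, eval k O c xs = Some v -> eval k' O c xs = Some v)
    by (intros; apply IH; [assumption|lia]).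
  destruct c; auto.
  - simpl in *.
    destruct (seq_opt (map (fun g => eval k O g xs) l)) eqn:E; [|discriminate].
    erewrite seq_opt_map_mono; [|intros g w Hw; exact (M g xs w Hw)|exact E]. auto.
  - destruct xs as [|n rest]; [discriminate|].
    rewrite eval_CPrimRec in *.
    eapply prec_eval_mono; [| |exact H]; cbv beta; intros; auto.
  - rewrite eval_CMu in *.
    eapply mu_eval_mono; [| |exact H]; cbv beta; intros; auto. lia.
Qed.

Lemma converges_fun O c xs v w : converges O c xs v -> converges O c xs w -> v = w.
Proof.
  intros [k H] [l H'].
  apply eval_mono with (k' := k + l) in H; [|lia].
  apply eval_mono with (k' := k + l) in H'; [|lia]. congruence.
Qed.

Lemma converges_CComp O f gs xs ys v :
  Forall2 (fun g y => converges O g xs y) gs ys -> converges O f ys v ->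
  converges O (CComp f gs) xs v.
Proof.
  intros H [k Hk].
  assert (E : exists l, seq_opt (map (fun g => eval l O g xs) gs) = Some ys).
  { clear Hk; induction H as [|g y gs ys [l Hl] _ [l' IH]]; [now exists 0|].
    exists (l + l'); simpl. rewrite (eval_mono O l (l + l') _ _ _ Hl) by lia.
    erewrite seq_opt_map_mono; [reflexivity| |exact IH].
    cbv beta; intros; eapply eval_mono; [eassumption|lia]. }
  destruct E as [l Hl]. exists (S (k + l)). simpl.
  erewrite seq_opt_map_mono; [| |exact Hl].
  - eapply eval_mono; [exact Hk|lia].
  - cbv beta; intros; eapply eval_mono; [eassumption|lia].
Qed.

Lemma converges_CPrimRec O b s n rest vb (vs : nat -> nat -> nat) :
  converges O b rest vb ->
  (forall m r, converges O s (m :: r :: rest) (vs m r)) ->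
  converges O (CPrimRec b s) (n :: rest) (nat_rect (fun _ => nat) vb vs n).
Proof.
  intros [k Hk] Hs.
  assert (E : exists l, prec_eval (eval l O b rest)
    (fun m r => eval l O s (m :: r :: rest)) n = Some (nat_rect (fun _ => nat) vb vs n)).
  { induction n as [|n [l IH]]; [now exists k|].
    destruct (Hs n (nat_rect (fun _ => nat) vb vs n)) as [l' Hl'].
    exists (l + l'); simpl.
    erewrite prec_eval_mono; [| | |exact IH]; cbv beta.
    - eapply eval_mono; [exact Hl'|lia].
    - intros; eapply eval_mono; [eassumption|lia].
    - intros; eapply eval_mono; [eassumption|lia]. }
  destruct E as [l Hl]. now exists (S l).
Qed.

Lemma halts_CMu O c xs (T : nat -> nat) :
  (forall t, converges O c (t :: xs) (T t)) ->
  (halts O (CMu c) xs <-> exists t, T t = 0).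
Proof.
  intros H; split.
  - intros [v [[|k] Hk]]; [discriminate|]. rewrite eval_CMu in Hk.
    assert (G : forall bound j,
      mu_eval (fun j => eval k O c (j :: xs)) j bound = Some v -> T v = 0).
    { induction bound as [|b IH]; simpl; intros j; [discriminate|].
      destruct (eval k O c (j :: xs)) as [[|w]|] eqn:E; [|apply IH|discriminate].
      intros [= <-]. eapply converges_fun; [apply H|now exists k]. }
    eauto.
  - intros [t Ht].
    assert (E : exists K, forall j, j <= t -> eval K O c (j :: xs) = Some (T j)).
    { clear Ht; induction t as [|t [K IH]].
      - destruct (H 0) as [K HK]; exists K; intros j Hj. now replace j with 0 by lia.
      - destruct (H (S t)) as [K' HK']. exists (K + K'). intros j Hj.
        destruct (Nat.eq_dec j (S t)) as [->|].
        + eapply eval_mono; [exact HK'|lia].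
        + eapply eval_mono; [apply IH; lia|lia]. }
    destruct E as [K HK].
    (* Fuel [K] evaluates the body at every [j <= t]; the extra [S t] pushes the search bound, which
       equals the fuel, beyond [t]. *)
    assert (G : forall bound j, j <= t -> t < j + bound ->
      exists v, mu_eval (fun j => eval (K + S t) O c (j :: xs)) j bound = Some v).
    { induction bound as [|b IH]; intros j Hj Hb; [lia|]; simpl.
      rewrite (eval_mono O K (K + S t) _ _ _ (HK j Hj)) by lia.
      destruct (T j) eqn:E; [now exists j|].
      assert (j <> t) by congruence. apply IH; lia. }
    destruct (G (K + S t) 0) as [v Hv]; [lia|lia|].
    exists v, (S (K + S t)). exact Hv.
Qed.

(** * Closure properties of computable functions *)

(** Functions act on the whole argument list, so that composition needs no currying. The code is
    held to account only on lists of length [k], since passing parameters on by projections requires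
    a known arity. *)
Definition computable (O : nat -> bool) (k : nat) (f : list nat -> nat) : Prop :=
  exists c, forall xs, length xs = k -> converges O c xs (f xs).

Lemma computable_ext O k f f' :
  (forall xs, f xs = f' xs) -> computable O k f -> computable O k f'.
Proof. intros E [c H]; exists c; intros xs Hx; rewrite <- E; auto. Qed.

Lemma computable_nth O k i : computable O k (fun xs => nth i xs 0).
Proof. exists (CProj i); intros; now exists 1. Qed.

Lemma computable_comp O m k F gs :
  computable O m F -> length gs = m -> Forall (computable O k) gs ->
  computable O k (fun xs => F (map (fun g => g xs) gs)).
Proof.
  intros [c Hc] Hl Hg.
  assert (E : exists cs, forall xs, length xs = k ->
    Forall2 (fun c y => converges O c xs y) cs (map (fun g => g xs) gs)).
  { clear Hl; induction Hg as [|g gs [d Hd] _ [ds IH]]; [exists []; constructor|].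
    exists (d :: ds); intros; constructor; auto. }
  destruct E as [cs Hcs]. exists (CComp c cs); intros xs Hx.
  eapply converges_CComp; [now apply Hcs|]. apply Hc. now rewrite length_map.
Qed.

Lemma map_nth_seq (l xs : list nat) :
  map (fun j => nth j (l ++ xs) 0) (seq (length l) (length xs)) = xs.
Proof.
  revert l; induction xs as [|x xs IH]; intros l; [reflexivity|]. simpl.
  rewrite app_nth2, Nat.sub_diag by lia. simpl. f_equal.
  specialize (IH (l ++ [x])). rewrite length_app, <- app_assoc in IH. simpl in IH.
  now rewrite Nat.add_1_r in IH.
Qed.

Lemma converges_projections O l xs :
  Forall2 (fun g y => converges O g (l ++ xs) y)
    (map CProj (seq (length l) (length xs))) xs.
Proof.
  assert (H : forall js, Forall2 (fun g y => converges O g (l ++ xs) y)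
    (map CProj js) (map (fun j => nth j (l ++ xs) 0) js)).
  { induction js; simpl; constructor; auto. now exists 1. }
  specialize (H (seq (length l) (length xs))). now rewrite map_nth_seq in H.
Qed.

Lemma computable_skipn2 O k f :
  computable O k f -> computable O (S (S k)) (fun ys => f (skipn 2 ys)).
Proof.
  intros [c Hc]. exists (CComp c (map CProj (seq 2 k))).
  intros [|a [|b xs]] H; simpl in H; try lia.
  eapply converges_CComp; [|apply Hc; simpl; lia]. simpl.
  replace k with (length xs) by lia.
  apply (converges_projections O [a; b] xs).
Qed.

(** [CPrimRec] recurses on its first argument, so the code prepends the value [n xs] to the
    parameters, which are copied by projections. *)
Lemma computable_rec O k n b (s : nat -> nat -> list nat -> nat) :
  computable O k b ->
  computable O (S (S k)) (fun ys => s (nth 0 ys 0) (nth 1 ys 0) (skipn 2 ys)) ->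
  computable O k n ->
  computable O k (fun xs => nat_rect (fun _ => nat) (b xs) (fun m r => s m r xs) (n xs)).
Proof.
  intros [cb Hb] [cs Hs] [cn Hn].
  exists (CComp (CPrimRec cb cs) (cn :: map CProj (seq 0 k))). intros xs Hx.
  apply converges_CComp with (ys := n xs :: xs).
  - constructor; auto. rewrite <- Hx. apply (converges_projections O [] xs).
  - apply converges_CPrimRec; auto. intros m r.
    apply (Hs (m :: r :: xs)). simpl; lia.
Qed.

Lemma computable_S O k f : computable O k f -> computable O k (fun xs => S (f xs)).
Proof.
  intros H. apply (computable_comp O 1 k (fun ys => S (hd 0 ys)) [f]); auto.
  exists CSucc; intros; now exists 1.
Qed.

Lemma computable_const O k n : computable O k (fun _ => n).
Proof.
  induction n; [|now apply computable_S].
  exists CZero; intros; now exists 1.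
Qed.

Lemma computable_oracle O k f :
  computable O k f -> computable O k (fun xs => Nat.b2n (O (f xs))).
Proof.
  intros H. apply (computable_comp O 1 k (fun ys => Nat.b2n (O (hd 0 ys))) [f]); auto.
  exists COrc; intros xs _; now exists 1.
Qed.

Definition computable1 O (a : nat -> nat) := computable O 1 (fun xs => a (nth 0 xs 0)).
Definition computable2 O (a : nat -> nat -> nat) :=
  computable O 2 (fun xs => a (nth 0 xs 0) (nth 1 xs 0)).

Lemma computable1_app O k a f :
  computable1 O a -> computable O k f -> computable O k (fun xs => a (f xs)).
Proof.
  intros Ha Hf. apply (computable_comp O 1 k (fun ys => a (nth 0 ys 0)) [f]); auto.
Qed.

Lemma computable2_app O k a f g :
  computable2 O a -> computable O k f -> computable O k g ->
  computable O k (fun xs => a (f xs) (g xs)).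
Proof.
  intros Ha Hf Hg.
  apply (computable_comp O 2 k (fun ys => a (nth 0 ys 0) (nth 1 ys 0)) [f; g]); auto.
Qed.

Lemma computable_add O k f g :
  computable O k f -> computable O k g -> computable O k (fun xs => f xs + g xs).
Proof.
  intros Hf Hg.
  apply computable_ext with
    (fun xs => nat_rect (fun _ => nat) (f xs) (fun _ r => S r) (g xs)).
  - intros xs; induction (g xs); simpl; lia.
  - apply (computable_rec O k g f (fun _ r _ => S r)); auto.
    apply computable_S, computable_nth.
Qed.

Lemma computable_pred O k f : computable O k f -> computable O k (fun xs => pred (f xs)).
Proof.
  intros Hf.
  apply computable_ext with
    (fun xs => nat_rect (fun _ => nat) 0 (fun m _ => m) (f xs)).
  - intros xs; destruct (f xs); reflexivity.
  - apply (computable_rec O k f (fun _ => 0) (fun m _ _ => m)); auto using computable_const.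
    apply computable_nth.
Qed.

Lemma computable_sub O k f g :
  computable O k f -> computable O k g -> computable O k (fun xs => f xs - g xs).
Proof.
  intros Hf Hg.
  apply computable_ext with
    (fun xs => nat_rect (fun _ => nat) (f xs) (fun _ r => pred r) (g xs)).
  - intros xs; induction (g xs); simpl; lia.
  - apply (computable_rec O k g f (fun _ r _ => pred r)); auto.
    apply computable_pred, computable_nth.
Qed.

Lemma computable_mul O k f g :
  computable O k f -> computable O k g -> computable O k (fun xs => f xs * g xs).
Proof.
  intros Hf Hg.
  apply computable_ext with
    (fun xs => nat_rect (fun _ => nat) 0 (fun _ r => r + f xs) (g xs)).
  - intros xs; induction (g xs); simpl; lia.
  - apply (computable_rec O k g (fun _ => 0) (fun _ r xs => r + f xs));
      auto using computable_const.
    apply computable_add; [apply computable_nth|now apply computable_skipn2].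
Qed.

Lemma computable_if O k c f g :
  computable O k c -> computable O k f -> computable O k g ->
  computable O k (fun xs => match c xs with 0 => f xs | S _ => g xs end).
Proof.
  intros Hc Hf Hg.
  apply computable_ext with
    (fun xs => nat_rect (fun _ => nat) (f xs) (fun _ _ => g xs) (c xs)).
  - intros xs; destruct (c xs); reflexivity.
  - apply (computable_rec O k c f (fun _ _ xs => g xs)); auto. now apply computable_skipn2.
Qed.

Lemma computable_odd O k f :
  computable O k f -> computable O k (fun xs => Nat.b2n (Nat.odd (f xs))).
Proof.
  intros Hf.
  apply computable_ext with
    (fun xs => nat_rect (fun _ => nat) 0 (fun _ r => 1 - r) (f xs)).
  - intros xs; induction (f xs) as [|n IH]; [reflexivity|].
    cbn [nat_rect]. rewrite IH, Nat.odd_succ, <- Nat.negb_odd.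
    now destruct (Nat.odd n).
  - apply (computable_rec O k f (fun _ => 0) (fun _ r _ => 1 - r)); auto using computable_const.
    apply computable_sub; [apply computable_const|apply computable_nth].
Qed.

Lemma computable_div2 O k f :
  computable O k f -> computable O k (fun xs => Nat.div2 (f xs)).
Proof.
  intros Hf.
  apply computable_ext with
    (fun xs => nat_rect (fun _ => nat) 0 (fun m r => r + Nat.b2n (Nat.odd m)) (f xs)).
  - intros xs; induction (f xs) as [|n IH]; [reflexivity|].
    cbn [nat_rect]. rewrite IH.
    pose proof (Nat.div2_odd n); pose proof (Nat.div2_odd (S n)).
    rewrite Nat.odd_succ, <- Nat.negb_odd in H0.
    destruct (Nat.odd n); simpl Nat.b2n in *; simpl negb in *; simpl Nat.b2n in *; lia.
  - apply (computable_rec O k f (fun _ => 0) (fun m r _ => r + Nat.b2n (Nat.odd m)));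
      auto using computable_const.
    apply computable_add; [apply computable_nth|apply computable_odd, computable_nth].
Qed.

Lemma computable_pow2 O k f :
  computable O k f -> computable O k (fun xs => 2 ^ f xs).
Proof.
  intros Hf.
  apply computable_ext with
    (fun xs => nat_rect (fun _ => nat) 1 (fun _ r => r + r) (f xs)).
  - intros xs; induction (f xs); simpl; lia.
  - apply (computable_rec O k f (fun _ => 1) (fun _ r _ => r + r));
      auto using computable_const, computable_add, computable_nth.
Qed.

Lemma computable_npair O k f g :
  computable O k f -> computable O k g -> computable O k (fun xs => npair (f xs) (g xs)).
Proof.
  intros Hf Hg.
  apply computable_ext with
    (fun xs => Nat.div2 ((f xs + g xs) * (f xs + g xs + 1)) + g xs).
  - intros xs; unfold npair; now rewrite Nat.div2_div.
  - auto 7 using computable_add, computable_mul, computable_const, computable_div2.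
Qed.

(** Zero stands for truth because [CMu] looks for a zero. With truncated subtraction, [a = b] is
    later written [(a - b) + (b - a)] and [a < b] is written [S a - b]. *)
Lemma semidecidable_exists O k (T : list nat -> nat) :
  computable O (S k) T ->
  exists c, forall xs, length xs = k ->
    (halts O c xs <-> exists t, T (t :: xs) = 0).
Proof.
  intros [c Hc]. exists (CMu c). intros xs Hx.
  apply (halts_CMu O c xs (fun t => T (t :: xs))).
  intros t; apply Hc; simpl; lia.
Qed.

(** * Numbering of codes *)

(** The pairs with sum [s] are numbered from the [s]-th triangular number [tri s] on, and [Mt] shows
    that different diagonals do not overlap. *)
Lemma npair_inj a b a' b' : npair a b = npair a' b' -> a = a' /\ b = b'.
Proof.
  unfold npair. set (tri s := s * (s + 1) / 2).
  assert (St : forall s, tri (S s) = tri s + S s).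
  { intros s; unfold tri.
    replace (S s * (S s + 1)) with (s * (s + 1) + S s * 2) by lia.
    now rewrite Nat.div_add by lia. }
  assert (Mt : forall s s', s < s' -> tri s + s < tri s').
  { intros s s' H; induction H; rewrite St; lia. }
  change ((a + b) * (a + b + 1) / 2) with (tri (a + b)).
  change ((a' + b') * (a' + b' + 1) / 2) with (tri (a' + b')).
  intros H. destruct (Nat.lt_trichotomy (a + b) (a' + b')) as [L|[L|L]].
  - specialize (Mt _ _ L); lia.
  - rewrite L in H; lia.
  - specialize (Mt _ _ L); lia.
Qed.

Definition encode_list :=
  fix encl (l : list code) : nat :=
    match l with [] => 0 | g :: l' => S (npair (encode g) (encl l')) end.

Fixpoint code_nested_ind (P : code -> Prop)
  (HZ : P CZero) (HS : P CSucc) (HP : forall i, P (CProj i)) (HO : P COrc)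
  (HC : forall f gs, P f -> Forall P gs -> P (CComp f gs))
  (HR : forall b s, P b -> P s -> P (CPrimRec b s))
  (HM : forall f, P f -> P (CMu f)) (c : code) : P c :=
  let rec := code_nested_ind P HZ HS HP HO HC HR HM in
  match c with
  | CZero => HZ | CSucc => HS | CProj i => HP i | COrc => HO
  | CComp f gs => HC f gs (rec f)
      ((fix all (l : list code) : Forall P l :=
          match l with
          | [] => Forall_nil P
          | g :: l' => Forall_cons g (rec g) (all l')
          end) gs)
  | CPrimRec b s => HR b s (rec b) (rec s)
  | CMu f => HM f (rec f)
  end.

Lemma encode_inj c c' : encode c = encode c' -> c = c'.
Proof.
  revert c'; induction c as [| |i| |f gs IHf IHg|b s IHb IHs|f IHf]
    using code_nested_ind; intros c' H; destruct c'; cbn [encode] in H;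
    apply npair_inj in H; destruct H as [H0 H]; try discriminate; auto.
  - apply npair_inj in H; destruct H as [H1 H2].
    f_equal; [auto|].
    change (encode_list gs = encode_list l) in H2.
    clear - H2 IHg. revert l H2; induction IHg as [|g gs Hg _ IH]; intros [|g' l] H;
      simpl in H; try discriminate; auto.
    injection H as H; apply npair_inj in H; destruct H. f_equal; auto.
  - apply npair_inj in H; destruct H. f_equal; auto.
  - f_equal; auto.
Qed.

Fixpoint cst (n : nat) : code :=
  match n with 0 => CZero | S n' => CComp CSucc [cst n'] end.

Lemma converges_cst O n xs : converges O (cst n) xs n.
Proof.
  induction n as [|n IH]; [now exists 1|]. simpl.
  eapply converges_CComp; [constructor; [exact IH|constructor]|now exists 1].
Qed.

Lemma eval_cst O k n xs v : eval k O (cst n) xs = Some v -> v = n.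
Proof. intros H. apply (converges_fun O (cst n) xs); [now exists k|apply converges_cst]. Qed.

(** The instance of the s-m-n theorem needed here. [halting_set] runs a code on its own number; a
    code with hard-wired arguments ignores that input, so any halting question on three arguments
    becomes a membership question. *)
Definition app3 (c : code) (x u v : nat) : code := CComp c [cst x; cst u; cst v].

Lemma halts_app3 O c x u v xs : halts O (app3 c x u v) xs <-> halts O c [x; u; v].
Proof.
  split.
  - intros [w [[|k] Hk]]; [discriminate|]. simpl in Hk.
    destruct (eval k O (cst x) xs) eqn:E1; [|discriminate].
    destruct (eval k O (cst u) xs) eqn:E2; [|discriminate].
    destruct (eval k O (cst v) xs) eqn:E3; [|discriminate].
    apply eval_cst in E1, E2, E3; subst. now exists w, k.
  - intros [w Hw]. exists w. eapply converges_CComp; [|exact Hw].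
    repeat constructor; apply converges_cst.
Qed.

(** Arithmetic counterpart of [encode] on constants, with 4 and 1 the tags of [CComp] and [CSucc];
    in this form the query number is visibly computable. *)
Definition cst_number (n : nat) : nat :=
  nat_rect (fun _ => nat) (npair 0 0)
    (fun _ r => npair 4 (npair (npair 1 0) (S (npair r 0)))) n.

Lemma encode_cst n : encode (cst n) = cst_number n.
Proof.
  induction n as [|n IH]; [reflexivity|].
  unfold cst_number. cbn [nat_rect]. fold (cst_number n). rewrite <- IH. reflexivity.
Qed.

Definition app3_number (g x u v : nat) : nat :=
  npair 4 (npair g (S (npair (cst_number x) (S (npair (cst_number u)
    (S (npair (cst_number v) 0))))))).

Lemma encode_app3 c x u v : encode (app3 c x u v) = app3_number (encode c) x u v.
Proof. unfold app3_number. rewrite <- !encode_cst. reflexivity. Qed.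

Lemma computable_cst_number O k f :
  computable O k f -> computable O k (fun xs => cst_number (f xs)).
Proof.
  intros Hf.
  apply (computable_rec O k f (fun _ => npair 0 0)
    (fun _ r _ => npair 4 (npair (npair 1 0) (S (npair r 0)))));
  auto 9 using computable_const, computable_npair, computable_S, computable_nth.
Qed.

Lemma computable_app3_number O k g x u v :
  computable O k g -> computable O k x -> computable O k u -> computable O k v ->
  computable O k (fun xs => app3_number (g xs) (x xs) (u xs) (v xs)).
Proof.
  intros. unfold app3_number.
  auto 12 using computable_const, computable_npair, computable_S, computable_cst_number.
Qed.

Lemma halting_set_app3 c x u v :
  halting_set (app3_number (encode c) x u v) <-> halts no_oracle c [x; u; v].
Proof.
  rewrite <- encode_app3, <- (halts_app3 no_oracle c x u v [encode (app3 c x u v)]).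
  split.
  - intros [c' [E H]]. apply encode_inj in E. now subst.
  - intros H. now exists (app3 c x u v).
Qed.

(** * Greedy strings computed with the halting problem *)

(** [enc_str] is bijective base-2 notation with digits 1 and 2, the first bit being least
    significant; a new last bit therefore adds one or two copies of a power of two. *)
Lemma enc_str_app s b :
  enc_str (s ++ [b]) = enc_str s + 2 ^ length s * (1 + Nat.b2n b).
Proof.
  induction s as [|c s IH]; simpl; [destruct b; simpl; lia|].
  rewrite IH. lia.
Qed.

Lemma enc_str_inj s t : enc_str s = enc_str t -> s = t.
Proof.
  revert t; induction s as [|b s IH]; intros [|c t] H; simpl in H; auto;
    try (destruct b; lia); try (destruct c; lia).
  destruct b, c; try lia; f_equal; apply IH; lia.
Qed.

Lemma enc_str_surj n : exists s, enc_str s = n.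
Proof.
  induction n as [n IH] using lt_wf_ind.
  destruct (Nat.eq_dec n 0) as [->|Hn]; [now exists []|].
  destruct (Nat.Even_or_Odd n) as [[m Hm]|[m Hm]].
  - destruct (IH (pred m)) as [s Hs]; [lia|]. exists (true :: s). simpl; lia.
  - destruct (IH m) as [s Hs]; [lia|]. exists (false :: s). simpl; lia.
Qed.

Lemma enc_str_bound s : 2 ^ length s <= S (enc_str s) < 2 ^ S (length s).
Proof. induction s as [|[] s IH]; simpl in *; lia. Qed.

Lemma enc_str_length_le s n : length s <= n <-> S (enc_str s) < 2 ^ S n.
Proof.
  pose proof (enc_str_bound s) as [H1 H2]. split; intros H.
  - apply Nat.lt_le_trans with (1 := H2). apply Nat.pow_le_mono_r; lia.
  - destruct (le_gt_dec (length s) n); auto.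
    assert (2 ^ S n <= 2 ^ length s) by (apply Nat.pow_le_mono_r; lia). lia.
Qed.

(** Predecessor followed by halving removes the lowest digit, whether it is 1 or 2. *)
Definition tail_number (x i : nat) : nat :=
  nat_rect (fun _ => nat) x (fun _ z => Nat.div2 (pred z)) i.

Lemma tail_number_enc_str s i : tail_number (enc_str s) i = enc_str (skipn i s).
Proof.
  induction i as [|i IH]; [reflexivity|].
  unfold tail_number in *; cbn [nat_rect]; rewrite IH.
  replace (skipn (S i) s) with (skipn 1 (skipn i s)) by (rewrite skipn_skipn; reflexivity).
  destruct (skipn i s) as [|b t]; [reflexivity|].
  cbn [enc_str skipn]. rewrite Nat.div2_div.
  symmetry; apply Nat.div_unique with (Nat.b2n b); destruct b; simpl; lia.
Qed.

Lemma odd_tail_number s i : i < length s ->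
  Nat.odd (tail_number (enc_str s) i) = negb (nth i s false).
Proof.
  intros Hi. rewrite tail_number_enc_str.
  assert (E : nth i s false = nth 0 (skipn i s) false)
    by (rewrite nth_skipn; now rewrite Nat.add_0_r).
  rewrite E. assert (L : length (skipn i s) > 0) by (rewrite length_skipn; lia).
  destruct (skipn i s) as [|b t]; [simpl in L; lia|]. cbn [enc_str nth].
  destruct b; cbn [negb].
  - replace (2 * enc_str t + 1 + 1) with (2 * (enc_str t + 1)) by lia.
    rewrite Nat.odd_mul. reflexivity.
  - replace (2 * enc_str t + 1 + 0) with (1 + 2 * enc_str t) by lia.
    rewrite Nat.odd_add_mul_2. reflexivity.
Qed.

Fixpoint prodn (f : nat -> nat) (n : nat) : nat :=
  match n with 0 => 1 | S m => prodn f m * f m end.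

Lemma prodn_ext f g n : (forall i, i < n -> f i = g i) -> prodn f n = prodn g n.
Proof. induction n; simpl; intros H; auto. rewrite H by lia. rewrite IHn; auto. Qed.

Lemma computable_prodn O k (f : nat -> list nat -> nat) n :
  computable O (S (S k)) (fun ys => f (nth 0 ys 0) (skipn 2 ys)) ->
  computable O k n ->
  computable O k (fun xs => prodn (fun i => f i xs) (n xs)).
Proof.
  intros Hf Hn.
  apply computable_ext with
    (fun xs => nat_rect (fun _ => nat) 1 (fun i r => r * f i xs) (n xs)).
  - intros xs; induction (n xs); simpl; auto.
  - apply (computable_rec O k n (fun _ => 1) (fun i r xs => r * f i xs)); auto.
    + apply computable_const.
    + apply computable_mul; auto. apply computable_nth.
Qed.

(** The numerator over [2 ^ k] of the truncation of the binary expansion to [k] bits. *)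
Fixpoint bits_number (pb : nat -> bool) (k : nat) : nat :=
  match k with 0 => 0 | S m => 2 * bits_number pb m + Nat.b2n (pb m) end.

Lemma computable_bits_number pb k f :
  computable pb k f -> computable pb k (fun xs => bits_number pb (f xs)).
Proof.
  intros Hf.
  apply computable_ext with
    (fun xs => nat_rect (fun _ => nat) 0 (fun i r => r + r + Nat.b2n (pb i)) (f xs)).
  - intros xs; induction (f xs) as [|n IH]; simpl; [reflexivity|rewrite IH; lia].
  - apply (computable_rec pb k f (fun _ => 0) (fun i r _ => r + r + Nat.b2n (pb i)));
      auto 6 using computable_const, computable_add, computable_nth, computable_oracle.
Qed.

(** Over [2 ^ (J + i)] this is the probability of bit [b] at position [i]. Numerators and
    denominators are multiplied separately and never reduced, so that queries to the halting set
    concern natural numbers only. *)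
Definition factor_num (pb : nat -> bool) (J i : nat) (b : bool) : nat :=
  if b then 2 ^ (J + i) - bits_number pb (J + i) else bits_number pb (J + i).

Definition weight_num (pb : nat -> bool) (J : nat) (s : str) : nat :=
  prodn (fun i => factor_num pb J i (nth i s false)) (length s).

Definition weight_den (J n : nat) : nat := prodn (fun i => 2 ^ (J + i)) n.

(** Works on the number [x] of a string of length [n]. An odd tail number has lowest digit 1, that
    is bit 0, hence the order of the branches. *)
Definition weight_num_code (pb : nat -> bool) (J x n : nat) : nat :=
  prodn (fun i => match Nat.b2n (Nat.odd (tail_number x i)) with
                  | 0 => factor_num pb J i true
                  | S _ => factor_num pb J i false
                  end) n.

Lemma weight_num_code_enc_str pb J s :
  weight_num_code pb J (enc_str s) (length s) = weight_num pb J s.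
Proof.
  apply prodn_ext; intros i Hi. rewrite odd_tail_number by exact Hi.
  now destruct (nth i s false).
Qed.

Lemma computable_weight_den O J k n :
  computable O k n -> computable O k (fun xs => weight_den J (n xs)).
Proof.
  intros Hn. apply (computable_prodn O k (fun i _ => 2 ^ (J + i))); auto.
  auto using computable_pow2, computable_add, computable_const, computable_nth.
Qed.

Lemma computable_weight_num_code pb J k x n :
  computable pb k x -> computable pb k n ->
  computable pb k (fun xs => weight_num_code pb J (x xs) (n xs)).
Proof.
  intros Hx Hn.
  apply (computable_prodn pb k (fun i xs =>
    match Nat.b2n (Nat.odd (tail_number (x xs) i)) with
    | 0 => factor_num pb J i true | S _ => factor_num pb J i false end)); auto.
  apply computable_if.
  - apply computable_odd.
    apply (computable_rec pb (S (S k)) (fun ys => nth 0 ys 0) (fun ys => x (skipn 2 ys))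
      (fun _ z _ => Nat.div2 (pred z)));
      auto using computable_skipn2, computable_nth, computable_div2, computable_pred.
  - unfold factor_num.
    auto 7 using computable_sub, computable_pow2, computable_add, computable_const,
      computable_nth, computable_bits_number.
  - unfold factor_num.
    auto 7 using computable_add, computable_const, computable_nth, computable_bits_number.
Qed.

Lemma characteristic_function A O : turing_reducible A O ->
  exists chi : nat -> nat, computable1 O chi /\
    forall n, (A n /\ chi n = 1) \/ (~ A n /\ chi n = 0).
Proof.
  intros [c Hc].
  exists (fun n => if excluded_middle_informative (A n) then 1 else 0). split.
  - exists c; intros [|n [|]] H; try discriminate H. simpl.
    destruct (excluded_middle_informative (A n)); now apply Hc.
  - intros n; destruct (excluded_middle_informative (A n)); auto.
Qed.

(* The query asks whether the code numbered [g] halts on the child [s0] of the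
   current string together with the numerator and denominator of its weight. *)
Fixpoint greedy_number (pb : nat -> bool) (J : nat) (chi : nat -> nat) (g n : nat) : nat :=
  match n with
  | 0 => 0
  | S m =>
      let x := greedy_number pb J chi g m + 2 ^ m in
      x + 2 ^ m * chi (app3_number g x (weight_num_code pb J x (S m)) (weight_den J (S m)))
  end.

Lemma computable_greedy_number pb J chi k g n :
  computable1 pb chi -> computable pb k g -> computable pb k n ->
  computable pb k (fun xs => greedy_number pb J chi (g xs) (n xs)).
Proof.
  intros Hchi Hg Hn.
  apply computable_ext with
    (fun xs => nat_rect (fun _ => nat) 0 (fun m r =>
       r + 2 ^ m + 2 ^ m * chi (app3_number (g xs) (r + 2 ^ m)
         (weight_num_code pb J (r + 2 ^ m) (S m)) (weight_den J (S m)))) (n xs)).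
  - intros xs; induction (n xs) as [|m IH]; [reflexivity|].
    cbn [nat_rect greedy_number]. now rewrite IH.
  - assert (H0 : computable pb (S (S k)) (fun ys => 2 ^ nth 0 ys 0))
      by auto using computable_pow2, computable_nth.
    assert (H1 : computable pb (S (S k)) (fun ys => nth 1 ys 0 + 2 ^ nth 0 ys 0))
      by auto using computable_add, computable_nth.
    assert (H2 : computable pb (S (S k)) (fun ys => S (nth 0 ys 0)))
      by auto using computable_S, computable_nth.
    apply (computable_rec pb k n (fun _ => 0) (fun m r xs =>
       r + 2 ^ m + 2 ^ m * chi (app3_number (g xs) (r + 2 ^ m)
         (weight_num_code pb J (r + 2 ^ m) (S m)) (weight_den J (S m)))));
      auto using computable_const.
    apply computable_add; auto. apply computable_mul; auto.
    apply (computable1_app pb _ chi); auto.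
    apply computable_app3_number; auto using computable_weight_den, computable_weight_num_code.
    now apply computable_skipn2.
Qed.

(** Adding [2 ^ m] appends a 0, and a positive answer adds another [2 ^ m], turning it into a 1.
    Hence every [g] yields a string, even one that is not the number of a useful code. *)
Lemma greedy_number_enc_str pb J chi g n :
  (forall m, chi m = 0 \/ chi m = 1) ->
  exists s, length s = n /\ greedy_number pb J chi g n = enc_str s.
Proof.
  intros Hchi; induction n as [|n [s [Hl Hs]]]; [now exists []|].
  cbn [greedy_number]. rewrite Hs. cbv zeta.
  match goal with |- context [chi ?z] => destruct (Hchi z) as [-> | ->] end.
  - exists (s ++ [false]). rewrite length_app, enc_str_app, Hl. simpl; lia.
  - exists (s ++ [true]). rewrite length_app, enc_str_app, Hl. simpl; lia.
Qed.

(** Level [n] receives one string for each number [g]; its length grows with [g] so that the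
    measures are dominated by a geometric series. *)
Definition greedy_test_spec pb J chi L c :=
  forall n s, test_set pb c n s <->
    exists g, length s = L * (g + n + 1) /\
      enc_str s = greedy_number pb J chi g (L * (g + n + 1)).

Lemma greedy_test pb J chi L :
  computable1 pb chi -> (forall m, chi m = 0 \/ chi m = 1) ->
  exists c, greedy_test_spec pb J chi L c.
Proof.
  intros Hc Hchi.
  (* Entry 0 is the [g] searched for, entry 1 the level and entry 2 the number of the string. *)
  set (W xs := greedy_number pb J chi (nth 0 xs 0) (L * (nth 0 xs 0 + nth 1 xs 0 + 1))).
  assert (HW : computable pb 3 W).
  { apply computable_greedy_number;
      auto 6 using computable_nth, computable_mul, computable_add, computable_const. }
  destruct (semidecidable_exists pb 2
    (fun xs => (W xs - nth 2 xs 0) + (nth 2 xs 0 - W xs))) as [c H].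
  { apply computable_add; apply computable_sub; auto using computable_nth. }
  exists c. intros n s. unfold test_set. rewrite H by reflexivity.
  unfold W; cbn [nth]. split; intros [g Hg]; exists g.
  - assert (E : enc_str s = greedy_number pb J chi g (L * (g + n + 1))) by lia.
    (* The length need not be tested separately: the number determines the string. *)
    destruct (greedy_number_enc_str pb J chi g (L * (g + n + 1)) Hchi) as [t [Ht Et]].
    rewrite Et in E. apply enc_str_inj in E. subst t. auto.
  - destruct Hg; lia.
Qed.
Open Scope R_scope.

(** * Left-c.e. functions *)

(** The denominator is a successor and thus never zero; [pred (S b * S d)] represents a product of
    two denominators. *)
Definition frac (a b : nat) : R := INR a / INR (S b).

Lemma frac_nonneg a b : 0 <= frac a b.
Proof. apply Rle_mult_inv_pos; [apply pos_INR|apply lt_0_INR; lia]. Qed.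

Lemma frac_plus a b c d :
  frac a b + frac c d = frac (a * S d + c * S b) (pred (S b * S d)).
Proof.
  unfold frac. rewrite Nat.succ_pred by lia.
  rewrite plus_INR, !mult_INR. field. split; apply not_0_INR; lia.
Qed.

Lemma frac_mult a b c d : frac a b * frac c d = frac (a * c) (pred (S b * S d)).
Proof.
  unfold frac. rewrite Nat.succ_pred by lia.
  rewrite !mult_INR. field. split; apply not_0_INR; lia.
Qed.

(** A version of [left_ce] with nonnegative approximations, convenient for the operations used
    below: sums, nonnegative rational multiples and case distinction by length. *)
Definition lower_approximable (F : str -> R) : Prop :=
  exists n e : nat -> nat -> nat,
    computable2 no_oracle n /\ computable2 no_oracle e /\
    forall s,
      (forall t, frac (n (enc_str s) t) (e (enc_str s) t)
                 <= frac (n (enc_str s) (S t)) (e (enc_str s) (S t))) /\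
      Un_cv (fun t => frac (n (enc_str s) t) (e (enc_str s) t)) (F s).

Lemma Un_cv_ext (u v : nat -> R) l : (forall n, u n = v n) -> Un_cv u l -> Un_cv v l.
Proof. intros E H eps He. destruct (H eps He) as [N HN]; exists N; intros; rewrite <- E; auto. Qed.

Lemma lower_approximable_const0 : lower_approximable (fun _ => 0).
Proof.
  exists (fun _ _ => 0%nat), (fun _ _ => 0%nat).
  split; [apply (computable_const no_oracle 2 0)|]. split; [apply (computable_const no_oracle 2 0)|].
  intros s; split; [intros; lra|].
  intros eps He; exists 0%nat; intros. unfold frac, Rdist; simpl.
  replace (0 / 1 - 0) with 0 by field. now rewrite Rabs_R0.
Qed.

Lemma lower_approximable_plus F G :
  lower_approximable F -> lower_approximable G -> lower_approximable (fun s => F s + G s).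
Proof.
  intros (n1 & e1 & Hn1 & He1 & H1) (n2 & e2 & Hn2 & He2 & H2).
  exists (fun x t => n1 x t * S (e2 x t) + n2 x t * S (e1 x t))%nat,
    (fun x t => pred (S (e1 x t) * S (e2 x t))).
  split; [|split].
  - apply computable_add; apply computable_mul; auto using computable_S.
  - apply computable_pred, computable_mul; auto using computable_S.
  - intros s; destruct (H1 s) as [M1 C1], (H2 s) as [M2 C2]; split.
    + intros t. rewrite <- !frac_plus. apply Rplus_le_compat; auto.
    + eapply Un_cv_ext; [intros; apply frac_plus|]. now apply CV_plus.
Qed.

Lemma lower_approximable_scale k l F :
  lower_approximable F -> lower_approximable (fun s => frac k l * F s).
Proof.
  intros (n & e & Hn & He & H).
  exists (fun x t => k * n x t)%nat, (fun x t => pred (S l * S (e x t))).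
  split; [|split].
  - apply computable_mul; auto using computable_const.
  - apply computable_pred, computable_mul; auto using computable_S, computable_const.
  - intros s; destruct (H s) as [M C]; split.
    + intros t. rewrite <- !frac_mult. apply Rmult_le_compat_l; auto using frac_nonneg.
    + eapply Un_cv_ext; [intros; apply frac_mult|].
      apply (CV_mult (fun _ => frac k l)); auto.
      intros eps Hp; exists 0%nat; intros. unfold Rdist.
      now rewrite Rminus_diag, Rabs_R0.
Qed.

Lemma lower_approximable_if_length m F G :
  lower_approximable F -> lower_approximable G ->
  lower_approximable (fun s => if (length s <=? m)%nat then F s else G s).
Proof.
  intros (n1 & e1 & Hn1 & He1 & H1) (n2 & e2 & Hn2 & He2 & H2).
  (* Vanishes exactly when the string numbered [x] has length at most [m], by
     [enc_str_length_le]. *)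
  set (test x := (S (S x) - 2 ^ S m)%nat).
  assert (Ht : computable no_oracle 2 (fun xs => test (nth 0 xs 0%nat))).
  { apply computable_sub; auto using computable_S, computable_const, computable_nth. }
  exists (fun x t => match test x with O => n1 x t | S _ => n2 x t end),
    (fun x t => match test x with O => e1 x t | S _ => e2 x t end).
  split; [|split]; try now apply computable_if.
  intros s. pose proof (enc_str_length_le s m) as E.
  destruct (Nat.leb_spec (length s) m) as [L|L].
  - replace (test (enc_str s)) with 0%nat by (apply E in L; unfold test; lia). apply H1.
  - destruct (test (enc_str s)) eqn:T; [|apply H2].
    exfalso. assert (length s <= m)%nat by (apply E; unfold test in T; lia). lia.
Qed.

Lemma computable2_of_converges c a :
  (forall s t, converges no_oracle c [enc_str s; t] (a (enc_str s) t)) ->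
  computable2 no_oracle a.
Proof.
  intros H; exists c. intros [|x [|t [|]]] Hl; try discriminate Hl.
  destruct (enc_str_surj x) as [s <-]. apply H.
Qed.

(** Truncated subtraction replaces negative approximations by 0; this preserves monotonicity and, as
    [d] is nonnegative, the limit. *)
Lemma lower_approximable_left_ce d :
  (forall s, 0 <= d s) -> left_ce d -> lower_approximable d.
Proof.
  intros Hd (ca & cb & ce & a & b & e & Hc & Hm & Hl).
  assert (computable2 no_oracle a) by (apply computable2_of_converges with ca; apply Hc).
  assert (computable2 no_oracle b) by (apply computable2_of_converges with cb; apply Hc).
  assert (computable2 no_oracle e) by (apply computable2_of_converges with ce; apply Hc).
  exists (fun x t => a x t - b x t)%nat, e.
  split; [|split]; auto.
  - now apply computable_sub.
  - intros s.
    assert (E : forall t, frac (a (enc_str s) t - b (enc_str s) t) (e (enc_str s) t) =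
      Rmax 0 ((INR (a (enc_str s) t) - INR (b (enc_str s) t)) / INR (S (e (enc_str s) t)))).
    { intros t; unfold frac.
      set (A := a (enc_str s) t); set (B := b (enc_str s) t).
      assert (P : 0 < / INR (S (e (enc_str s) t)))
        by (apply Rinv_0_lt_compat, lt_0_INR; lia).
      unfold Rdiv; destruct (le_lt_dec B A) as [L|L].
      - rewrite minus_INR by exact L. apply le_INR in L. rewrite Rmax_right; auto.
        apply Rmult_le_pos; lra.
      - replace (A - B)%nat with 0%nat by lia. apply lt_INR in L.
        rewrite Rmax_left; [simpl; ring|]. apply Rlt_le, Rmult_neg_pos; lra. }
    split.
    + intros t; rewrite !E. specialize (Hm s t).
      apply Rmax_lub; [apply Rmax_l|]. eapply Rle_trans; [exact Hm|apply Rmax_r].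
    + eapply Un_cv_ext; [intros t; symmetry; apply E|].
      intros eps He. destruct (Hl s eps He) as [N HN]. exists N; intros t Ht.
      specialize (HN t Ht). specialize (Hd s). unfold Rdist in *.
      revert HN; unfold Rmax, Rabs; repeat destruct Rcase_abs; destruct Rle_dec; lra.
Qed.

Definition comparison_code (F : str -> R) (c : code) : Prop :=
  forall s u v, (0 < v)%nat ->
    (halts no_oracle c [enc_str s; u; v] <-> INR u / INR v < F s).

(** The limit of a nondecreasing sequence exceeds a rational iff some stage does, so the code
    searches for that stage after cross-multiplying. *)
Lemma lower_approximable_comparison F :
  lower_approximable F -> exists c, comparison_code F c.
Proof.
  intros (n & e & Hn & He & H).
  destruct (semidecidable_exists no_oracle 3 (fun ys =>
    (S (nth 2 ys 0 * S (e (nth 1 ys 0) (nth 0 ys 0)))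
     - n (nth 1 ys 0) (nth 0 ys 0) * nth 3 ys 0)%nat)) as [c Hc].
  { apply computable_sub; [apply computable_S|]; apply computable_mul;
      try apply computable_S; try apply (computable2_app no_oracle 4 _ _ _ He);
      try apply (computable2_app no_oracle 4 _ _ _ Hn); apply computable_nth. }
  exists c. intros s u v Hv. rewrite Hc by reflexivity. cbn [nth].
  destruct (H s) as [M C].
  assert (Q : forall t, (S (u * S (e (enc_str s) t)) - n (enc_str s) t * v)%nat = 0%nat
    <-> INR u / INR v < frac (n (enc_str s) t) (e (enc_str s) t)).
  { intros t. unfold frac.
    assert (P1 : 0 < INR v) by now apply lt_0_INR.
    assert (P2 : 0 < INR (S (e (enc_str s) t))) by (apply lt_0_INR; lia).
    transitivity (INR u * INR (S (e (enc_str s) t)) < INR (n (enc_str s) t) * INR v).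
    - rewrite <- !mult_INR. split; intros K; [apply lt_INR|apply INR_lt in K]; lia.
    - split; intros K.
      + apply Rmult_lt_reg_r with (INR v); auto.
        apply Rmult_lt_reg_r with (INR (S (e (enc_str s) t))); auto.
        field_simplify; lra.
      + apply Rmult_lt_compat_r with (r := INR v * INR (S (e (enc_str s) t))) in K;
          [|now apply Rmult_lt_0_compat].
        field_simplify in K; lra. }
  split.
  - intros [t Ht]. apply Q in Ht. eapply Rlt_le_trans; [exact Ht|].
    now apply (growing_ineq (fun t => frac (n (enc_str s) t) (e (enc_str s) t))).
  - intros K. destruct (C (F s - INR u / INR v)) as [N HN]; [lra|].
    exists N. apply Q. specialize (HN N (le_n N)). unfold Rdist in HN.
    apply Rabs_def2 in HN. lra.
Qed.

(** * Product measures with truncated parameters and their greedy strings *)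

Fixpoint prodr (f : nat -> R) (n : nat) : R :=
  match n with 0%nat => 1 | S m => prodr f m * f m end.

Lemma prodr_ext f g n : (forall i, (i < n)%nat -> f i = g i) -> prodr f n = prodr g n.
Proof. induction n; simpl; intros H; auto. rewrite H by lia. rewrite IHn; auto. Qed.

Definition factor (q : nat -> R) (i : nat) (b : bool) : R := if b then 1 - q i else q i.

(* The measure of [s] for independent bits, the [i]-th being 0 with probability [q i]. *)
Definition weight (q : nat -> R) (s : str) : R :=
  prodr (fun i => factor q i (nth i s false)) (length s).

Lemma weight_snoc q s b : weight q (s ++ [b]) = weight q s * factor q (length s) b.
Proof.
  unfold weight. rewrite length_app; cbn [length]. rewrite Nat.add_1_r. cbn [prodr].
  rewrite nth_middle. f_equal. apply prodr_ext; intros i Hi. now rewrite app_nth1.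
Qed.

Lemma weight_pos q s : (forall i, 0 < q i < 1) -> 0 < weight q s.
Proof.
  intros Hq. unfold weight. induction (length s) as [|n IH]; simpl; [lra|].
  apply Rmult_lt_0_compat; auto. unfold factor. specialize (Hq n). destruct nth; lra.
Qed.

Lemma bin_partial_S pb n :
  bin_partial pb (S n) = bin_partial pb n + (if pb n then (/2) ^ S n else 0).
Proof.
  unfold bin_partial. rewrite seq_S, map_app, fold_right_app. simpl (0 + n)%nat.
  cbn [map fold_right]. set (x := if pb n then _ else _).
  generalize (map (fun i => if pb i then (/ 2) ^ S i else 0) (seq 0 n)) as l.
  induction l as [|y l IH]; cbn [fold_right]; lra.
Qed.

Lemma INR_pow2 k : INR (2 ^ k) = 2 ^ k.
Proof. rewrite pow_INR. reflexivity. Qed.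

Lemma bin_partial_bits_number pb k : bin_partial pb k = INR (bits_number pb k) / 2 ^ k.
Proof.
  induction k as [|k IH]; [unfold bin_partial; simpl; field|].
  rewrite bin_partial_S, IH. cbn [bits_number].
  rewrite plus_INR, mult_INR, pow_inv. simpl (INR 2). cbn [pow].
  assert (2 ^ k <> 0) by (apply pow_nonzero; lra).
  destruct (pb k); simpl (INR (Nat.b2n _)); field; auto.
Qed.

Lemma bits_number_le pb k : (bits_number pb k <= 2 ^ k)%nat.
Proof.
  assert (bits_number pb k < 2 ^ k)%nat; [|lia].
  induction k as [|k IH]; simpl; [lia|]. destruct (pb k); simpl; lia.
Qed.

(** The offset [J] is chosen later, so large that all parameters are positive and the truncation
    errors are small relative to [1 - p]. *)
Definition prob (pb : nat -> bool) (J i : nat) : R := bin_partial pb (J + i).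

Lemma weight_num_den pb J s :
  weight (prob pb J) s = INR (weight_num pb J s) / INR (weight_den J (length s)).
Proof.
  unfold weight, weight_num, weight_den.
  induction (length s) as [|n IH]; simpl; [field|].
  rewrite IH, !mult_INR. unfold factor, factor_num, prob.
  rewrite bin_partial_bits_number, INR_pow2.
  assert (2 ^ (J + n) <> 0) by (apply pow_nonzero; lra).
  assert (INR (prodn (fun i => 2 ^ (J + i))%nat n) <> 0).
  { apply not_0_INR. clear. induction n; simpl; [lia|].
    pose proof (Nat.pow_nonzero 2 (J + n)). nia. }
  destruct nth; [rewrite minus_INR, INR_pow2 by apply bits_number_le|]; field; auto.
Qed.

Lemma weight_den_pos J n : (0 < weight_den J n)%nat.
Proof.
  unfold weight_den; induction n; simpl; [lia|].
  pose proof (Nat.pow_nonzero 2 (J + n)). nia.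
Qed.

Fixpoint greedy (q : nat -> R) (F : str -> R) (n : nat) : str :=
  match n with
  | 0%nat => []
  | S m => let s := greedy q F m in
           s ++ [if Rlt_dec (weight q (s ++ [false])) (F (s ++ [false])) then true else false]
  end.

Lemma length_greedy q F n : length (greedy q F n) = n.
Proof. induction n; simpl; auto. rewrite length_app, IHn. simpl; lia. Qed.

(** This allows [F] to be replaced on long strings without disturbing the bits already chosen. *)
Lemma greedy_ext q F G m :
  (forall s, (length s <= m)%nat -> F s = G s) ->
  forall n, (n <= m)%nat -> greedy q F n = greedy q G n.
Proof.
  intros E; induction n as [|n IH]; intros Hn; [reflexivity|]. simpl.
  rewrite IH by lia. rewrite E; [reflexivity|].
  rewrite length_app, length_greedy. simpl; lia.
Qed.

Lemma greedy_number_greedy pb J chi F c n :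
  (forall n, (halting_set n /\ chi n = 1%nat) \/ (~ halting_set n /\ chi n = 0%nat)) ->
  comparison_code F c ->
  greedy_number pb J chi (encode c) n = enc_str (greedy (prob pb J) F n).
Proof.
  intros Hchi Hc; induction n as [|n IH]; [reflexivity|].
  cbn [greedy_number greedy]. rewrite IH. cbv zeta.
  set (s := greedy (prob pb J) F n).
  assert (Ls : length s = n) by apply length_greedy.
  assert (E : (enc_str s + 2 ^ n)%nat = enc_str (s ++ [false]))
    by (rewrite enc_str_app, Ls; simpl; lia).
  assert (L : length (s ++ [false]) = S n) by (rewrite length_app; simpl; lia).
  rewrite E. rewrite <- L at 1. rewrite weight_num_code_enc_str.
  set (z := app3_number _ _ _ _).
  (* The oracle answers the strict real comparison exactly, because the weight is the rational
     passed to the query. *)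
  assert (Q : halting_set z <-> weight (prob pb J) (s ++ [false]) < F (s ++ [false])).
  { unfold z. rewrite halting_set_app3, weight_num_den, L.
    apply Hc, weight_den_pos. }
  rewrite enc_str_app, Ls, enc_str_app, Ls.
  destruct Rlt_dec as [D|D]; rewrite <- Q in D; destruct (Hchi z) as [[A ->]|[A ->]];
    try contradiction; simpl; lia.
Qed.

Lemma mu_snoc p s b : mu p (s ++ [b]) = mu p s * (if b then 1 - p else p).
Proof.
  unfold mu, count0, count1. rewrite !count_occ_app, !pow_add.
  destruct b; simpl; ring.
Qed.

Lemma mu_pos p s : 0 < p < 1 -> 0 < mu p s.
Proof. intros H; apply Rmult_lt_0_compat; apply pow_lt; lra. Qed.

Lemma mu_le_pow p th s : 0 <= p <= th -> 0 <= 1 - p <= th -> mu p s <= th ^ length s.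
Proof.
  intros H0 H1.
  assert (P : forall t, 0 <= mu p t)
    by (intros t; apply Rmult_le_pos; apply pow_le; lra).
  induction s as [|b s IH] using rev_ind; [unfold mu; simpl; lra|].
  rewrite mu_snoc, length_app; simpl length. rewrite Nat.add_1_r; simpl pow.
  rewrite Rmult_comm. apply Rmult_le_compat; auto; destruct b; lra.
Qed.

(** A bit 0 gains nothing since [q i <= p]. A bit 1 costs a factor at most
    [1 + (/2) ^ i <= exp ((/2) ^ i)], and the exponents over all positions sum to 2; the induction
    keeps the partial sum [2 - 2 * (/2) ^ length s]. *)
Lemma weight_le_mu q p s :
  p < 1 -> (forall i, 0 < q i <= p) -> (forall i, p - q i <= (1 - p) * (/2) ^ i) ->
  weight q s <= exp 2 * mu p s.
Proof.
  intros Hp Hq Hc.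
  assert (Hq' : forall i, 0 < q i < 1) by (intros i; specialize (Hq i); lra).
  assert (H : weight q s <= exp (2 - 2 * (/2) ^ length s) * mu p s).
  { induction s as [|b s IH] using rev_ind.
    - unfold weight, mu; simpl. replace (2 - 2 * 1) with 0 by ring. rewrite exp_0; lra.
    - rewrite weight_snoc, mu_snoc, length_app; simpl length. rewrite Nat.add_1_r.
      replace (2 - 2 * (/2) ^ S (length s))
        with ((2 - 2 * (/2) ^ length s) + (/2) ^ length s) by (simpl; field).
      rewrite exp_plus.
      set (E := exp (2 - _)) in *. set (h := (/2) ^ length s) in *.
      assert (Hh : 0 < h) by (apply pow_lt; lra).
      pose proof (exp_ineq1_le h) as Hx.
      specialize (Hq (length s)); specialize (Hc (length s)); fold h in Hc.
      replace (E * exp h * (mu p s * (if b then 1 - p else p)))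
        with (E * mu p s * (exp h * (if b then 1 - p else p))) by ring.
      apply Rmult_le_compat; auto.
      + now apply Rlt_le, weight_pos.
      + destruct b; simpl; lra.
      + destruct b; simpl; nra. }
  assert (Hm : 0 < mu p s) by (apply mu_pos; specialize (Hq 0%nat); lra).
  eapply Rle_trans; [exact H|]. apply Rmult_le_compat_r; [lra|].
  assert (0 < (/2) ^ length s) by (apply pow_lt; lra).
  apply Rlt_le, exp_increasing; lra.
Qed.

(** * The greedy strings form a Martin-Loef test *)

Definition lsum (l : list R) : R := fold_right Rplus 0 l.

Lemma lsum_app l l' : lsum (l ++ l') = lsum l + lsum l'.
Proof. induction l; simpl in *; lra. Qed.

Lemma lsum_incl (f : nat -> R) l l' :
  (forall x, 0 <= f x) -> NoDup l -> incl l l' -> lsum (map f l) <= lsum (map f l').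
Proof.
  intros Hf Hl; revert l'; induction Hl as [|x l Hx _ IH]; intros l' Hi.
  - simpl. clear - Hf; induction l'; simpl; [lra|]. specialize (Hf a); lra.
  - destruct (in_split x l') as [l1 [l2 ->]]; [apply Hi; now left|].
    specialize (IH (l1 ++ l2)).
    assert (incl l (l1 ++ l2)).
    { intros z Hz. specialize (Hi z (or_intror Hz)). apply in_app_or in Hi.
      apply in_or_app. destruct Hi as [|[->|]]; tauto. }
    specialize (IH H). rewrite map_app, lsum_app in *. simpl. lra.
Qed.

(** Distinct indices lie in an initial segment of the naturals, over which the geometric series
    stays below one half. *)
Lemma lsum_thirds l : NoDup l -> lsum (map (fun g => (/3) ^ S g) l) <= /2.
Proof.
  intros Hl.
  eapply Rle_trans; [apply lsum_incl with (l' := seq 0 (S (list_max l))); auto|].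
  - intros; apply pow_le; lra.
  - intros x Hx. apply in_seq.
    assert (x <= list_max l)%nat; [|lia].
    pose proof (proj1 (list_max_le l (list_max l)) (le_n _)) as F.
    rewrite Forall_forall in F; auto.
  - assert (E : forall n, lsum (map (fun g => (/3) ^ S g) (seq 0 n)) = /2 - /2 * (/3) ^ n).
    { induction n as [|n IH]; [simpl; lra|].
      rewrite seq_S, map_app, lsum_app, IH. simpl. field. }
    rewrite E. assert (0 < (/3) ^ S (list_max l)) by (apply pow_lt; lra). lra.
Qed.

(** A string of index [g] in level [n] has measure at most [th ^ (L * (g + n + 1)) <= (/3) ^ (n + S
    g)]. Different strings have different indices, so the level has measure at most
    [(/3) ^ n / 2]. *)
Lemma ML_test_greedy pb p J chi L c th :
  greedy_test_spec pb J chi L c ->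
  0 <= p <= th -> 0 <= 1 - p <= th -> th ^ L <= /3 -> ML_test pb p c.
Proof.
  intros Hc H0 H1 HL n l Hpf Hl.
  assert (E : exists gs, NoDup gs /\
    (forall g, In g gs -> exists s, In s l /\
       enc_str s = greedy_number pb J chi g (L * (g + n + 1))) /\
    lsum (map (mu p) l) <= lsum (map (fun g => (/3) ^ (n + S g)) gs)).
  { induction Hpf as [|s l Hs Hpf IH].
    - exists []; split; [constructor|]. split; [intros _ []|]. simpl; lra.
    - inversion Hl as [|? ? Ts Tl]; subst.
      destruct (IH Tl) as (gs & Hn & Hg & Hsum).
      apply Hc in Ts as (g & Lg & Eg).
      exists (g :: gs). split; [|split].
      (* A repeated index would mean a repeated string, and a string is a prefix of itself. *)
      + constructor; auto. intros I. destruct (Hg g I) as (t & It & Et).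
        rewrite <- Eg in Et. apply enc_str_inj in Et; subst t.
        rewrite Forall_forall in Hs. apply (Hs s It). exists []. now rewrite app_nil_r.
      + intros g' [<-|I]; [now exists s; split; [left|]|].
        destruct (Hg g' I) as (t & It & Et). exists t; split; auto. now right.
      + cbn [map lsum fold_right]. apply Rplus_le_compat; [|exact Hsum].
        eapply Rle_trans; [apply mu_le_pow with (th := th); auto|].
        rewrite Lg, pow_mult. replace (g + n + 1)%nat with (n + S g)%nat by lia.
        apply pow_incr. split; auto. apply pow_le; lra. }
  destruct E as (gs & Hn & _ & Hsum).
  eapply Rle_trans; [exact Hsum|].
  assert (E : lsum (map (fun g => (/3) ^ (n + S g)) gs)
              = (/3) ^ n * lsum (map (fun g => (/3) ^ S g) gs)).
  { clear. induction gs; cbn [map lsum fold_right]; [ring|].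
    unfold lsum in IHgs; rewrite IHgs, pow_add. ring. }
  rewrite E. pose proof (lsum_thirds gs Hn).
  assert (0 < (/3) ^ n) by (apply pow_lt; lra).
  assert ((/3) ^ n <= (/2) ^ n) by (apply pow_incr; lra). nra.
Qed.

(** * Listing the left-c.e. semimeasures *)

Definition left_ce_by (ca cb ce : code) (d : str -> R) : Prop :=
  exists a b e : nat -> nat -> nat,
    (forall s t, converges no_oracle ca [enc_str s; t] (a (enc_str s) t)
               /\ converges no_oracle cb [enc_str s; t] (b (enc_str s) t)
               /\ converges no_oracle ce [enc_str s; t] (e (enc_str s) t)) /\
    forall s, Un_cv (fun t => (INR (a (enc_str s) t) - INR (b (enc_str s) t))
                              / INR (S (e (enc_str s) t))) (d s).

Lemma left_ce_by_unique ca cb ce d d' :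
  left_ce_by ca cb ce d -> left_ce_by ca cb ce d' -> forall s, d s = d' s.
Proof.
  intros (a & b & e & Hc & Hl) (a' & b' & e' & Hc' & Hl') s.
  eapply UL_sequence; [apply Hl|]. eapply Un_cv_ext; [|apply Hl'].
  intros t. destruct (Hc s t) as (A & B & E), (Hc' s t) as (A' & B' & E').
  rewrite (converges_fun _ _ _ _ _ A A'), (converges_fun _ _ _ _ _ B B'),
    (converges_fun _ _ _ _ _ E E'). reflexivity.
Qed.

Definition approximable_semimeasure (d : str -> R) : Prop :=
  semimeasure d /\ lower_approximable d.

Lemma choice_function (A B : Type) (R : A -> B -> Prop) :
  (forall a, exists b, R a b) -> exists f, forall a, R a (f a).
Proof.
  intros H. exists (fun a => proj1_sig (constructive_indefinite_description _ (H a))).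
  intros a. apply proj2_sig.
Qed.

(** Only countability is wanted, not effectiveness: each semimeasure is determined by three codes,
    and [ds k] is chosen classically among those named by [k], with the zero function as default. *)
Lemma left_ce_semimeasure_enumeration :
  exists ds : nat -> str -> R, (forall k, approximable_semimeasure (ds k)) /\
    forall d, left_ce_semimeasure d -> exists k, forall s, ds k s = d s.
Proof.
  set (named k d := left_ce_semimeasure d /\ exists ca cb ce,
    left_ce_by ca cb ce d /\ npair (encode ca) (npair (encode cb) (encode ce)) = k).
  assert (H : forall k, exists d, approximable_semimeasure d /\
    ((exists d', named k d') -> named k d)).
  { intros k. destruct (classic (exists d', named k d')) as [[d Hd]|N].
    - exists d; split; [|tauto]. destruct Hd as [[S C] _]. split; auto.
      apply lower_approximable_left_ce; auto. intros s; apply S.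
    - exists (fun _ => 0); split; [|tauto]. split; [|apply lower_approximable_const0].
      unfold semimeasure. repeat split; intros; lra. }
  apply choice_function in H. destruct H as [ds H]. exists ds. split; [apply H|].
  intros d Hd. destruct Hd as [S C].
  assert (C' := C). destruct C' as (ca & cb & ce & a & b & e & Hc & Hm & Hl).
  assert (B : left_ce_by ca cb ce d) by (exists a, b, e; auto).
  exists (npair (encode ca) (npair (encode cb) (encode ce))).
  destruct (H (npair (encode ca) (npair (encode cb) (encode ce)))) as [_ H'].
  destruct H' as (_ & ca' & cb' & ce' & B' & E).
  { exists d. split; [split; auto|]. now exists ca, cb, ce. }
  apply npair_inj in E as [E1 E]. apply npair_inj in E as [E2 E3].
  apply encode_inj in E1, E2, E3; subst.
  eapply left_ce_by_unique; eassumption.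
Qed.

(** * Switching between greedy sequences *)

(** [H] is the mixture built so far and [F] the function whose greedy sequence is followed. They
    agree only beyond length [m]: on shorter strings [F] keeps earlier values so that the prefix
    already fixed remains greedy for it. *)
Definition invariant (q : nat -> R) (H F : str -> R) (m : nat) : Prop :=
  lower_approximable H /\ lower_approximable F /\
  (forall s, 0 <= H s) /\ (forall s, H (s ++ [false]) + H (s ++ [true]) <= H s) /\
  (forall s, (m < length s)%nat -> F s = H s) /\
  (forall n, (m <= n)%nat -> H (greedy q F n) <= weight q (greedy q F n)).

(** If [H] exceeds the weight at the 0-child, then the semimeasure inequality leaves less than the
    weight for the 1-child; otherwise the 0-child is safe. *)
Lemma greedy_supermartingale_step q H F m :
  (forall s, H (s ++ [false]) + H (s ++ [true]) <= H s) ->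
  (forall s, (m < length s)%nat -> F s = H s) ->
  H (greedy q F m) <= weight q (greedy q F m) ->
  forall n, (m <= n)%nat -> H (greedy q F n) <= weight q (greedy q F n).
Proof.
  intros Hs HF H0 n Hn; induction Hn as [|n Hn IH]; auto. simpl.
  set (s := greedy q F n) in *.
  assert (E : F (s ++ [false]) = H (s ++ [false])).
  { apply HF. unfold s; rewrite length_app, length_greedy; simpl; lia. }
  rewrite E. specialize (Hs s).
  destruct Rlt_dec as [D|D]; [|lra].
  revert D; rewrite !weight_snoc; simpl. lra.
Qed.

(** With [l = mix_coef i], the old mixture gets coefficient [frac l l], which is 1 minus the inverse
    square of [i + 2], and the new term gets the rest. The product of these coefficients telescopes
    and stays away from 0, so no semimeasure once added fades out. *)
Definition mix_coef (i : nat) : nat := pred ((i + 2) * (i + 2)).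

Lemma frac_mix l : frac l l + frac 1 l = 1.
Proof. unfold frac. rewrite S_INR. simpl (INR 1). pose proof (pos_INR l). field; lra. Qed.

Lemma invariant_step q H F m d i L :
  (forall i, 0 < q i < 1) ->
  invariant q H F m -> approximable_semimeasure d ->
  exists H' F' m', invariant q H' F' m' /\ (m < m')%nat /\
    (exists c, comparison_code F c /\ (L * (encode c + i + 1) <= m')%nat) /\
    (forall s, (length s <= m')%nat -> F' s = F s) /\
    (forall s, frac (mix_coef i) (mix_coef i) * H s <= H' s) /\
    exists gam, 0 < gam /\ forall s, gam * d s <= H' s.
Proof.
  intros Hq (AH & AF & PH & SH & EF & BH) [[Pd [_ Sd]] Ad].
  destruct (lower_approximable_comparison F AF) as [c Hc].
  (* The switch waits until the string that [F] contributes to level [i] of the test is complete;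
     [S m] forces progress. *)
  set (m' := Nat.max (S m) (L * (encode c + i + 1))).
  assert (Hm : (m < m')%nat) by lia.
  set (s0 := greedy q F m').
  assert (W : 0 < weight q s0) by now apply weight_pos.
  (* As [d] is at most 1, scaling it by [1 / K] brings it below the weight at [s0], so the convex
     combination [H'] is below it as well. *)
  destruct (archimed_cor1 _ W) as [K [HK K0]].
  set (l := mix_coef i).
  set (H' s := frac l l * H s + frac 1 l * (frac 1 (pred K) * d s)).
  set (F' s := if (length s <=? m')%nat then F s else H' s).
  assert (P1 : 0 <= frac l l) by apply frac_nonneg.
  assert (P2 : 0 < frac 1 l)
    by (apply Rdiv_lt_0_compat; [simpl; lra|apply lt_0_INR; lia]).
  assert (P3 : 0 < frac 1 (pred K))
    by (apply Rdiv_lt_0_compat; [simpl; lra|apply lt_0_INR; lia]).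
  assert (P3' : frac 1 (pred K) < weight q s0).
  { unfold frac. rewrite Nat.succ_pred by lia. simpl (INR 1).
    unfold Rdiv; now rewrite Rmult_1_l. }
  assert (P4 : 0 < frac 1 l * frac 1 (pred K)) by now apply Rmult_lt_0_compat.
  assert (AH' : lower_approximable H').
  { apply lower_approximable_plus; repeat apply lower_approximable_scale; auto. }
  assert (SH' : forall s, H' (s ++ [false]) + H' (s ++ [true]) <= H' s).
  { intros s; unfold H'. specialize (SH s); specialize (Sd s). nra. }
  assert (EF' : forall s, (length s <= m')%nat -> F' s = F s).
  { intros s Hs; unfold F'. apply Nat.leb_le in Hs. now rewrite Hs. }
  assert (EFH : forall s, (m' < length s)%nat -> F' s = H' s).
  { intros s Hs; unfold F'. destruct (Nat.leb_spec (length s) m'); [lia|reflexivity]. }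
  assert (G : greedy q F' m' = s0) by (apply greedy_ext with m'; auto).
  exists H', F', m'. split; [|split; [|split; [|split; [|split]]]]; auto.
  - repeat split; auto.
    + now apply lower_approximable_if_length.
    + intros s; unfold H'. specialize (PH s); specialize (Pd s). nra.
    + apply greedy_supermartingale_step; auto. rewrite G; unfold H'.
      assert (H s0 <= weight q s0) by (apply BH; lia).
      specialize (Pd s0). pose proof (frac_mix l) as M.
      assert (frac 1 (pred K) * d s0 <= weight q s0) by nra.
      replace (weight q s0)
        with (frac l l * weight q s0 + frac 1 l * weight q s0)
        by (rewrite <- Rmult_plus_distr_r, M; ring).
      apply Rplus_le_compat; apply Rmult_le_compat_l; lra.
  - exists c; split; auto. lia.
  - intros s; unfold H'; fold l. specialize (Pd s). nra.
  - exists (frac 1 l * frac 1 (pred K)); split; auto.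
    intros s; unfold H'. specialize (PH s). nra.
Qed.

Lemma dependent_choice (A : Type) (P : A -> Prop) (R : nat -> A -> A -> Prop) a0 :
  P a0 -> (forall i a, P a -> exists b, P b /\ R i a b) ->
  exists f : nat -> A, (forall i, P (f i)) /\ forall i, R i (f i) (f (S i)).
Proof.
  intros H0 H.
  assert (H' : forall ia : nat * A, exists b, P (snd ia) -> P b /\ R (fst ia) (snd ia) b).
  { intros [i a]; simpl. destruct (classic (P a)) as [Ha|Ha].
    - destruct (H i a Ha) as [b Hb]; eauto.
    - exists a; tauto. }
  apply choice_function in H'. destruct H' as [step Hstep].
  set (f := fix f i := match i with 0%nat => a0 | S j => step (j, f j) end).
  assert (Hf : forall i, P (f i)).
  { induction i as [|i IH]; simpl; auto. now apply (Hstep (i, f i)). }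
  exists f; split; auto. intros i. apply (Hstep (i, f i)); apply Hf.
Qed.

(** Closed form of the telescoping product of the coefficients [frac l l]; it decreases but stays
    above 1. *)
Definition shrink (i : nat) : R := INR (i + 2) / INR (i + 1).

Lemma shrink_S i : shrink (S i) = frac (mix_coef i) (mix_coef i) * shrink i.
Proof.
  unfold shrink, frac, mix_coef. rewrite Nat.succ_pred by lia.
  rewrite <- Nat.sub_1_r, minus_INR, !mult_INR by lia.
  rewrite !plus_INR, S_INR. simpl (INR 1); simpl (INR 2).
  pose proof (pos_INR i). field. lra.
Qed.

Lemma shrink_gt_1 i : 1 < shrink i.
Proof.
  unfold shrink. rewrite !plus_INR; simpl (INR 1); simpl (INR 2).
  pose proof (pos_INR i). apply Rmult_lt_reg_r with (INR i + 1); [lra|].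
  field_simplify; lra.
Qed.

(** The greedy strings of the successive [F i] extend one another up to the switching lengths
    [m (S i)], and [y] is their limit. A semimeasure entering at stage [e] is bounded by a constant
    times every later [H i], which is bounded by the weight along its stretch of [y]. *)
Lemma greedy_sequence q L :
  (forall i, 0 < q i < 1) ->
  exists y : nat -> bool,
    (forall i, exists F c, comparison_code F c /\
       let n := (L * (encode c + i + 1))%nat in prefix y n = greedy q F n) /\
    forall d, left_ce_semimeasure d -> exists C N, forall n, (N <= n)%nat ->
      d (prefix y n) <= C * weight q (prefix y n).
Proof.
  intros Hq.
  destruct left_ce_semimeasure_enumeration as [ds [Hds Hall]].
  set (P (x : (str -> R) * (str -> R) * nat) := invariant q (fst (fst x)) (snd (fst x)) (snd x)).
  set (R i (x x' : (str -> R) * (str -> R) * nat) :=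
    (snd x < snd x')%nat /\
    (exists c, comparison_code (snd (fst x)) c /\ (L * (encode c + i + 1) <= snd x')%nat) /\
    (forall s, (length s <= snd x')%nat -> snd (fst x') s = snd (fst x) s) /\
    (forall s, frac (mix_coef i) (mix_coef i) * fst (fst x) s <= fst (fst x') s) /\
    exists gam, 0 < gam /\ forall s, gam * ds i s <= fst (fst x') s).
  destruct (dependent_choice _ P R ((fun _ => 0), (fun _ => 0), 0%nat)) as [f [Pf Rf]].
  { split; [|split; [|split; [|split; [|split]]]]; simpl;
      try apply lower_approximable_const0; intros; try lra.
    now apply Rlt_le, weight_pos. }
  { intros i [[H F] m] I. simpl in I.
    destruct (invariant_step q H F m (ds i) i L Hq I (Hds i)) as (H' & F' & m' & I' & R').
    exists (H', F', m'). split; auto. }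
  set (H i := fst (fst (f i))) in *. set (F i := snd (fst (f i))) in *.
  set (m i := snd (f i)) in *.
  assert (Hlt : forall i, (m i < m (S i))%nat) by (intros i; apply (Rf i)).
  assert (Hmono : forall i j, (i <= j)%nat -> (m i <= m j)%nat).
  { intros i j Hij; induction Hij; auto. specialize (Hlt m0); lia. }
  assert (Hge : forall i, (i <= m i)%nat).
  { induction i as [|i IH]; [lia|]. specialize (Hlt i); lia. }
  assert (Hext : forall i j, (i <= j)%nat -> forall s, (length s <= m (S i))%nat -> F j s = F i s).
  { intros i j Hij; induction Hij as [|j Hij IH]; intros s Hs; auto.
    rewrite <- IH by auto. destruct (Rf j) as (_ & _ & E & _). apply E.
    fold (m (S j)). specialize (Hmono (S i) (S j)); lia. }
  assert (Hgr : forall i j n, (n <= m (S i))%nat -> (n <= m (S j))%nat ->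
    greedy q (F i) n = greedy q (F j) n).
  { assert (X : forall i j n, (i <= j)%nat -> (n <= m (S i))%nat ->
      greedy q (F i) n = greedy q (F j) n).
    { intros i j n Hij Hn. apply greedy_ext with (m (S i)); auto.
      intros; symmetry; apply Hext; auto. }
    intros i j n Hi Hj. destruct (le_lt_dec i j); auto. symmetry; apply X; lia. }
  (* Stage [n] already fixes bit [n], because [S n <= m (S n)]. *)
  set (y n := nth n (greedy q (F n) (S n)) false).
  assert (Hy : forall n i, (n <= m (S i))%nat -> prefix y n = greedy q (F i) n).
  { induction n as [|n IH]; intros i Hn; [reflexivity|].
    cbn [prefix]. rewrite (IH i) by lia. unfold y.
    rewrite (Hgr n i (S n)); auto. cbn [greedy]. f_equal. f_equal.
    rewrite app_nth2; rewrite length_greedy; [now rewrite Nat.sub_diag|lia]. }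
  exists y. split.
  - intros i. destruct (Rf i) as (_ & (c & Hc & Hl) & _).
    exists (F i), c. split; auto.
  - intros d Hd. destruct (Hall d Hd) as [e He].
    destruct (Rf e) as (_ & _ & _ & _ & gam & Hgam & Hbound).
    fold (H (S e)) in Hbound.
    set (del := gam / shrink (S e)).
    assert (Hdel : 0 < del)
      by (pose proof (shrink_gt_1 (S e)); apply Rdiv_lt_0_compat; lra).
    assert (Hd0 : forall s, 0 <= d s) by (intros s; apply Hd).
    (* Dividing by [shrink (S e)] makes the start of the induction the bound by [gam]; each later
       mixing multiplies [shrink] by exactly the coefficient lost. *)
    assert (HH : forall i, (S e <= i)%nat -> forall s, del * shrink i * d s <= H i s).
    { intros i Hi; induction Hi as [|i Hi IH]; intros s.
      - unfold del. replace (gam / shrink (S e) * shrink (S e)) with gam.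
        + rewrite <- He. auto.
        + field. pose proof (shrink_gt_1 (S e)); lra.
      - destruct (Rf i) as (_ & _ & _ & Hm & _). specialize (Hm s).
        fold (H (S i)) (H i) in Hm. rewrite shrink_S. specialize (IH s).
        pose proof (frac_nonneg (mix_coef i) (mix_coef i)). nra. }
    exists (/ del), (m (S e)).
    (* Between lengths [m i] and [m (S i)], [y] is greedy for [F i] and [H i] is below the weight
       there. *)
    assert (Hstage : forall i n, (S e <= i)%nat -> (m i <= n <= m (S i))%nat ->
      d (prefix y n) <= / del * weight q (prefix y n)).
    { intros i n Hi Hn. rewrite (Hy n i) by lia.
      destruct (Pf i) as (_ & _ & _ & _ & _ & B). specialize (B n (proj1 Hn)).
      fold (H i) (F i) in B. set (s := greedy q (F i) n) in *.
      specialize (HH i Hi s). specialize (Hd0 s). pose proof (shrink_gt_1 i).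
      apply Rmult_le_reg_l with del; auto. rewrite <- Rmult_assoc, Rinv_r by lra.
      assert (0 <= (del * d s) * (shrink i - 1))
        by (apply Rmult_le_pos; [apply Rmult_le_pos|]; lra).
      lra. }
    assert (Hn : forall i, (S e <= i)%nat -> forall n, (m (S e) <= n <= m i)%nat ->
      d (prefix y n) <= / del * weight q (prefix y n)).
    { intros i Hi; induction Hi as [|i Hi IH]; intros n Hn.
      - apply (Hstage (S e)); auto. specialize (Hlt (S e)); lia.
      - destruct (le_lt_dec n (m i)); [apply IH; lia|]. apply (Hstage i); auto; lia. }
    intros n Hn'. apply (Hn (S e + n)%nat); [lia|]. specialize (Hge (S e + n)%nat); lia.
Qed.

(** * Bounds for binary expansions, choice of the constants and proof of the theorem *)

Lemma bin_partial_bounds pb p : is_binary_expansion pb p ->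
  forall n, bin_partial pb n <= p <= bin_partial pb n + (/2) ^ n.
Proof.
  intros H n.
  assert (P : forall k, 0 < (/2) ^ k) by (intros; apply pow_lt; lra).
  split.
  - apply growing_ineq with (Un := bin_partial pb); auto.
    intros k. rewrite bin_partial_S. specialize (P (S k)). destruct (pb k); lra.
  - apply Rnot_lt_le; intros L.
    destruct (H (p - (bin_partial pb n + (/2) ^ n))) as [N HN]; [lra|].
    specialize (HN (n + N)%nat ltac:(lia)). apply Rabs_def2 in HN.
    assert (E : bin_partial pb (n + N) <= bin_partial pb n + (/2) ^ n - (/2) ^ (n + N)).
    { clear; induction N as [|N IH]; [rewrite Nat.add_0_r; lra|].
      rewrite Nat.add_succ_r, bin_partial_S.
      assert (0 < (/2) ^ S (n + N)) by (apply pow_lt; lra).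
      assert ((/2) ^ (n + N) = 2 * (/2) ^ S (n + N)) by (simpl; field).
      destruct (pb (n + N)%nat); lra. }
    specialize (P (n + N)%nat). lra.
Qed.

Lemma bin_partial_mono pb n k : bin_partial pb n <= bin_partial pb (n + k).
Proof.
  induction k as [|k IH]; [rewrite Nat.add_0_r; lra|].
  rewrite Nat.add_succ_r, bin_partial_S.
  assert (0 < (/2) ^ S (n + k)) by (apply pow_lt; lra).
  destruct (pb (n + k)%nat); lra.
Qed.

Lemma nonrandom_resisting_interior pb p :
  is_binary_expansion pb p -> turing_reducible halting_set pb -> 0 < p < 1 ->
  exists y : nat -> bool,
    ~ MLR_bern pb p y /\
    forall d, left_ce_semimeasure d -> ~ succeeds (blind_supermartingale p d) y.
Proof.
  intros Hexp HK Hp.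
  pose proof (bin_partial_bounds pb p Hexp) as Hb.
  (* Below [p / 2], the error of truncation to [J] bits leaves a positive parameter; below [1 - p],
     it yields the error bound of [weight_le_mu]. *)
  destruct (pow_lt_1_zero (/2) ltac:(rewrite Rabs_pos_eq; lra) (Rmin (p / 2) (1 - p)))
    as [J HJ]; [apply Rmin_pos; lra|].
  specialize (HJ J (le_n J)). rewrite Rabs_pos_eq in HJ by (apply pow_le; lra).
  assert (HJ1 : (/2) ^ J < p / 2) by (eapply Rlt_le_trans; [exact HJ|apply Rmin_l]).
  assert (HJ2 : (/2) ^ J < 1 - p) by (eapply Rlt_le_trans; [exact HJ|apply Rmin_r]).
  set (q := prob pb J).
  assert (Hq : forall i, 0 < q i <= p).
  { intros i; unfold q, prob. split; [|apply Hb].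
    pose proof (bin_partial_mono pb J i). specialize (Hb J). lra. }
  assert (Hqc : forall i, p - q i <= (1 - p) * (/2) ^ i).
  { intros i; unfold q, prob. specialize (Hb (J + i)%nat). rewrite pow_add in Hb.
    assert (0 < (/2) ^ i) by (apply pow_lt; lra). nra. }
  set (th := Rmax p (1 - p)).
  assert (T0 : 0 <= p <= th) by (split; [lra|apply Rmax_l]).
  assert (T1 : 0 <= 1 - p <= th) by (split; [lra|apply Rmax_r]).
  assert (T2 : th < 1) by (apply Rmax_lub_lt; lra).
  (* Strings of length [L] have measure at most one third. *)
  destruct (pow_lt_1_zero th ltac:(rewrite Rabs_pos_eq; lra) (/3)) as [L HL]; [lra|].
  specialize (HL L (le_n L)). rewrite Rabs_pos_eq in HL by (apply pow_le; lra).
  destruct (characteristic_function halting_set pb HK) as (chi & Cchi & Hchi).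
  assert (Hchi01 : forall m, chi m = 0%nat \/ chi m = 1%nat)
    by (intros m; specialize (Hchi m); tauto).
  destruct (greedy_test pb J chi L Cchi Hchi01) as [c Hc].
  destruct (greedy_sequence q L) as (y & Hy & Hd).
  { intros i; specialize (Hq i); lra. }
  exists y. split.
  - intros M. apply (M c).
    + apply (ML_test_greedy pb p J chi L c th); auto; lra.
    + intros n. destruct (Hy n) as (F & e & He & E). cbv zeta in E.
      exists (L * (encode e + n + 1))%nat. apply Hc. exists (encode e).
      rewrite E, length_greedy. split; auto.
      symmetry. now apply greedy_number_greedy.
  - intros d Hds S. destruct (Hd d Hds) as (C & N & HC).
    (* The absolute value is taken because the sign of [C] is not known. *)
    destruct (S (Rabs C * exp 2) N) as (n & Hn & HB).
    specialize (HC n Hn). unfold blind_supermartingale in HB.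
    set (s := prefix y n) in *.
    pose proof (mu_pos p s Hp) as Hm.
    pose proof (weight_le_mu q p s (proj2 Hp) Hq Hqc) as W.
    assert (W0 : 0 < weight q s) by (apply weight_pos; intros i; specialize (Hq i); lra).
    pose proof (Rle_abs C) as A. pose proof (Rabs_pos C).
    apply Rmult_lt_compat_r with (r := mu p s) in HB; auto.
    unfold Rdiv in HB. rewrite Rmult_assoc, (Rmult_assoc (d s)), Rinv_l, Rmult_1_r in HB by lra.
    assert (C * weight q s <= Rabs C * weight q s) by (apply Rmult_le_compat_r; lra).
    assert (Rabs C * weight q s <= Rabs C * (exp 2 * mu p s))
      by (apply Rmult_le_compat_l; lra).
    lra.
Qed.

(** For the boundary cases, where a single null cylinder serves as every level. The search variable
    is ignored: the search stops at 0 or never. *)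
Lemma constant_test O (s0 : str) :
  exists c, forall n s, test_set O c n s <-> s = s0.
Proof.
  set (k := enc_str s0).
  destruct (semidecidable_exists O 2
    (fun ys => (nth 2 ys 0 - k) + (k - nth 2 ys 0))%nat) as [c H].
  { apply computable_add; apply computable_sub;
      auto using computable_nth, computable_const. }
  exists c. intros n s. unfold test_set. rewrite H by reflexivity. cbn [nth].
  split.
  - intros [_ E]. apply enc_str_inj. fold k. lia.
  - intros ->. exists 0%nat. fold k. lia.
Qed.

(* If [mu] vanishes on [b], then so does the junk quotient [d / mu] along [bbb...]. *)
Lemma nonrandom_resisting_boundary pb p b :
  0 <= p <= 1 -> mu p [b] = 0 ->
  exists y : nat -> bool,
    ~ MLR_bern pb p y /\
    forall d, left_ce_semimeasure d -> ~ succeeds (blind_supermartingale p d) y.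
Proof.
  intros Hp Hb. exists (fun _ => b). split.
  - destruct (constant_test pb [b]) as [c Hc]. intros M. apply (M c).
    + intros n l Hpf Hl.
      assert (E : forall l', Forall (test_set pb c n) l' ->
        fold_right Rplus 0 (map (mu p) l') = 0).
      { induction 1 as [|s l' Hs _ IH]; [reflexivity|].
        apply Hc in Hs; subst. simpl. rewrite IH, Hb. ring. }
      rewrite E by exact Hl. apply pow_le; lra.
    + intros n. exists 1%nat. now apply Hc.
  - intros d Hd S. destruct (S 0 1%nat) as (n & Hn & HB).
    unfold blind_supermartingale in HB.
    assert (Z : mu p (prefix (fun _ => b) n) = 0).
    { destruct n as [|n]; [lia|]. clear - Hb. induction n as [|n IH]; [exact Hb|].
      change (prefix (fun _ => b) (S (S n))) with (prefix (fun _ => b) (S n) ++ [b]).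
      rewrite mu_snoc, IH. ring. }
    rewrite Z in HB. unfold Rdiv in HB. rewrite Rinv_0, Rmult_0_r in HB. lra.
Qed.

Theorem mainTheorem18 (pb : nat -> bool) (pr : R)
  (Hexp : is_binary_expansion pb pr)
  (HK : turing_reducible halting_set pb) :
  exists y : nat -> bool,
    ~ MLR_bern pb pr y /\
    forall d : str -> R, left_ce_semimeasure d ->
      ~ succeeds (blind_supermartingale pr d) y.
Proof.
  (* The empty partial sum gives [0 <= pr <= 1]. *)
  pose proof (bin_partial_bounds pb pr Hexp 0) as H.
  unfold bin_partial in H; simpl in H.
  destruct (Req_dec pr 0) as [->|H0].
  - apply (nonrandom_resisting_boundary pb 0 false); [lra|unfold mu; simpl; ring].
  - destruct (Req_dec pr 1) as [->|H1].
    + apply (nonrandom_resisting_boundary pb 1 true); [lra|unfold mu; simpl; ring].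
    + apply nonrandom_resisting_interior; auto; lra.
Qed.
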